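(* Let $R,S$ be Dedekind domains with torsion class group, and let $h:G(R)\longrightarrow G(S)$ be a homeomorphism. Let $h_e:R\longrightarrow S$ be the extension of $h$ with $h_e(0)=0$. Let $I$ be a radical ideal of $R$. Then the following hold. (a) $h_e(I)$ is a radical ideal of $S$. (b) The number of prime ideals of $R$ containing $I$ is equal to the number of prime ideals of $S$ containing $h_e(I)$. (c) If $I$ is prime, then $h_e(I)$ is prime.
   Context: A Dedekind domain is a one-dimensional Noetherian integrally closed domain. For an integral domain $R$, set $R^\bullet:=R\setminus\{0\}$. The Golomb space $G(R)$ is the set $R^\bullet$ endowed with the topology generated by the cosets $a+I$, where $a\in R$ and $I$ is a nonzero ideal of $R$ such that $\langle a,I\rangle=R$. The class group of $R$ is the group of nonzero fractional ideals of $R$ modulo principal fractional ideals. *)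

(* Defs.v *)
From HB Require Import structures.
From mathcomp Require Import all_boot all_order all_algebra.
From mathcomp Require Import all_classical topology.
Set Implicit Arguments.
Unset Strict Implicit.
Unset Printing Implicit Defensive.
Import GRing.Theory.
Local Open Scope classical_set_scope.
Local Open Scope ring_scope.

(* MathComp's idealr_closed forces an ideal to be proper; here the unit ideal  *)
(* is allowed, and properness reappears only for prime ideals.                 *)
Definition is_ideal (R : idomainType) (I : set R) : Prop :=
  0 \in I /\ forall a, {in I &, forall u v, a * u + v \in I}.

Definition is_prime_ideal (R : idomainType) (P : set R) : Prop :=
  idealr_closed (mem P) /\ prime_idealr_closed (mem P).

Definition ideal_span (R : idomainType) (A : set R) : set R :=
  smallest (@is_ideal R) A.

Definition radical (R : idomainType) (I : set R) : set R :=
  [set x | exists2 n, (0 < n)%N & x ^+ n \in I].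

Definition is_radical_ideal (R : idomainType) (I : set R) : Prop :=
  is_ideal I /\ radical I = I.

Definition noetherian (R : idomainType) : Prop :=
  forall I : set R, is_ideal I -> exists s : seq R, I = ideal_span [set` s].

Definition integrally_closed (R : idomainType) : Prop :=
  forall z : {fraction R},
    integralOver (@tofrac R) z -> exists a : R, z = tofrac a.

(* P 0 < P 1 < ... < P n ; the values of P beyond n are irrelevant. *)
Definition prime_chain (R : idomainType) (n : nat) (P : nat -> set R) : Prop :=
  (forall i, (i <= n)%N -> is_prime_ideal (P i)) /\
  (forall i, (i < n)%N -> P i `<` P i.+1).

Definition has_krull_dim (R : idomainType) (d : nat) : Prop :=
  (exists P : nat -> set R, prime_chain d P) /\
  (forall n (P : nat -> set R), prime_chain n P -> (n <= d)%N).

Definition dedekind (R : idomainType) : Prop :=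
  [/\ noetherian R, integrally_closed R & has_krull_dim R 1].

Definition nonzero_fractional_ideal (R : idomainType) (J : set {fraction R}) :
    Prop :=
  [/\ 0 \in J,
      forall a : R, {in J &, forall u v, tofrac a * u + v \in J},
      exists2 d : R, d != 0 &
        {in J, forall u, exists a : R, tofrac d * u = tofrac a}
    & exists2 u, u \in J & u != 0].

Definition frac_mul (R : idomainType) (J K : set {fraction R}) :
    set {fraction R} :=
  [set x | exists2 s : seq ({fraction R} * {fraction R}),
     {in s, forall p, p.1 \in J /\ p.2 \in K} & x = \sum_(p <- s) p.1 * p.2].

Definition frac_exp (R : idomainType) (J : set {fraction R}) (n : nat) :
    set {fraction R} :=
  iter n (frac_mul J) (range (@tofrac R)).

Definition principal_fractional_ideal (R : idomainType)
    (J : set {fraction R}) : Prop :=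
  exists2 x : {fraction R}, x != 0 & J = [set tofrac a * x | a in [set: R]].

(* The class of J has finite order in the quotient by the principal fractional *)
(* ideals iff some positive power of J is principal.                           *)
Definition torsion_class_group (R : idomainType) : Prop :=
  forall J : set {fraction R}, nonzero_fractional_ideal J ->
    exists2 n, (0 < n)%N & principal_fractional_ideal (frac_exp J n).

Definition golomb (R : idomainType) : Type := {x : R | x != 0}.

HB.instance Definition _ (R : idomainType) := SubChoice.copy (golomb R) {x : R | x != 0}.

(* For I = R the coset a + I contains 0, hence the trace on the nonzero        *)
(* elements.                                                                   *)
Definition golomb_subbase (R : idomainType) : set (set (golomb R)) :=
  [set U | exists (a : R) (I : set R),
     [/\ is_ideal I, I != [set 0], ideal_span (a |` I) = [set: R]
       & U = [set x : golomb R | val x \in [set a + i | i in I]]]].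

HB.instance Definition _ (R : idomainType) :=
  isSubBaseTopological.Build (golomb R) (@golomb_subbase R) id.

Definition is_homeomorphism (T U : topologicalType) (f : T -> U) : Prop :=
  exists g : U -> T, [/\ cancel f g, cancel g f, continuous f & continuous g].

Definition golomb_ext (R S : idomainType) (h : golomb R -> golomb S) (x : R) :
    S :=
  if insub x is Some u then val (h u) else 0.

Definition primes_containing (R : idomainType) (I : set R) : set (set R) :=
  [set P | is_prime_ideal P /\ I `<=` P].

(* Main.v *)
Require Import Defs.
From HB Require Import structures.
From mathcomp Require Import all_boot all_order all_algebra.
From mathcomp Require Import all_classical topology.
From mathcomp Require Import ring.
Import GRing.Theory.
Local Open Scope classical_set_scope.
Local Open Scope ring_scope.

(** A homeomorphism can only preserve what the topology sees, so the point is to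
    express divisibility by primes topologically. The tool is the closure of
    open sets. If [I] is an ideal comaximal to [c], the closure of [c + I]
    contains the nonzero elements of the radical of [I]
    ([closure_open_sup]); and if [Q] is [P]-primary, the closure of
    [c + Q] is contained in the union of [P] and [c + Q] ([closure_coset_sub]).

    Given a set [A] of points, consider the filter generated by the closures of
    the open sets meeting [A]. Two points [a] and [b] outside a nonzero prime
    [P] put [P] in the filter, as the closures of [a + Q] and [b + Q] meet
    inside [P] for small [P]-primary [Q]. A single point outside [P] does not
    suffice, since [P]-adically the filter then keeps the points near [a].
    Hence the filter contains the closures of all nonempty open sets, a
    topological condition on [A] called [closure_generating], exactly when every
    nonzero prime leaves out at least two points of [A]
    ([generating_of_two_outside], [two_outside_of_generating]).

    It follows that every prime containing [x] contains [y] if and only if [y]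
    can be replaced by [x] in all such sets, for [A] avoiding [x]
    ([replaceableP]). So a homeomorphism [h] carries the radical of the
    principal ideal of [x] to the radical of the principal ideal of [h x].
    Torsion of the class group makes every nonzero radical ideal of this form
    ([radical_ideal_prime_hull]), whence the claim on radical ideals. The
    correspondence preserves inclusions, and the nonzero primes are the maximal
    proper ideals, so primes go to primes ([is_prime_ideal_image]). Applied to
    [h] and to its inverse, this gives a bijection between the primes
    containing a radical ideal and those containing its image. *)

Set Implicit Arguments.
Unset Strict Implicit.
Unset Printing Implicit Defensive.

(** * Ideals of a noetherian domain *)

Section Ideals.
Variable R : idomainType.
Implicit Types (I J P Q : set R) (a b c x y z : R).

(** Membership in a classical set is handled as the proposition [I x]
    throughout, rather than through the boolean [x \in I]. *)
Lemma is_idealP I : is_ideal I <->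
  I 0 /\ forall a u v, I u -> I v -> I (a * u + v).
Proof.
split=> [[I0 IM]|[I0 IM]]; split.
- by rewrite in_setE in I0.
- by move=> a u v Iu Iv; rewrite -in_setE; apply: IM; rewrite in_setE.
- by rewrite in_setE.
- by move=> a u v; rewrite !in_setE; apply: IM.
Qed.

Section Closure.
Variables (I : set R) (idI : is_ideal I).

Lemma is_ideal0 : I 0. Proof. by have /is_idealP[] := idI. Qed.

Lemma is_idealMl a u : I u -> I (a * u).
Proof.
have /is_idealP[I0 IM] := idI; move=> Iu.
by rewrite -[_ * _]addr0; apply: IM.
Qed.

Lemma is_idealMr a u : I u -> I (u * a).
Proof. by rewrite mulrC; apply: is_idealMl. Qed.

Lemma is_idealD u v : I u -> I v -> I (u + v).
Proof.
have /is_idealP[I0 IM] := idI; move=> Iu Iv.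
by rewrite -[u]mul1r; apply: IM.
Qed.

Lemma is_idealN u : I u -> I (- u).
Proof. by move=> Iu; rewrite -mulN1r; apply: is_idealMl. Qed.

Lemma is_idealB u v : I u -> I v -> I (u - v).
Proof. by move=> Iu Iv; apply: is_idealD => //; apply: is_idealN. Qed.

End Closure.

Lemma ideal_build I : I 0 -> (forall u v, I u -> I v -> I (u + v)) ->
  (forall a u, I u -> I (a * u)) -> is_ideal I.
Proof.
move=> I0 ID IM; apply/is_idealP; split=> // a u v Iu Iv.
by apply: ID => //; apply: IM.
Qed.

Lemma is_ideal_setI I J : is_ideal I -> is_ideal J -> is_ideal (I `&` J).
Proof.
move=> idI idJ; apply: ideal_build.
- by split; apply: is_ideal0.
- by move=> u v [Iu Ju] [Iv Jv]; split; apply: is_idealD.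
- by move=> a u [Iu Ju]; split; apply: is_idealMl.
Qed.

Definition multiples x : set R := [set y | exists r, y = r * x].

Lemma is_ideal_multiples x : is_ideal (multiples x).
Proof.
apply: ideal_build; first by exists 0; rewrite mul0r.
- by move=> _ _ [r ->] [s ->]; exists (r + s); rewrite mulrDl.
- by move=> a _ [r ->]; exists (a * r); rewrite mulrA.
Qed.

Definition adjoin I x : set R := [set y | exists i r, I i /\ y = i + r * x].

Lemma is_ideal_adjoin I x : is_ideal I -> is_ideal (adjoin I x).
Proof.
move=> idI; apply: ideal_build.
- by exists 0, 0; split; [exact: is_ideal0|rewrite mul0r addr0].
- move=> _ _ [i [r [Ii ->]]] [j [s [Ij ->]]].
  by exists (i + j), (r + s); split; [exact: is_idealD|ring].
- move=> a _ [i [r [Ii ->]]].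
  by exists (a * i), (a * r); split; [exact: is_idealMl|ring].
Qed.

Lemma sub_adjoin I x : is_ideal I -> I `<=` adjoin I x.
Proof. by move=> idI i Ii; exists i, 0; split=> //; ring. Qed.

Lemma mem_adjoin I x : is_ideal I -> adjoin I x x.
Proof. by move=> idI; exists 0, 1; split; [exact: is_ideal0|ring]. Qed.

Lemma adjoinM I u v x y : is_ideal I -> I (u * v) ->
  adjoin I u x -> adjoin I v y -> I (x * y).
Proof.
move=> idI Iuv [i [r [Ii ->]]] [j [s [Ij ->]]].
have -> : (i + r * u) * (j + s * v) =
  (j + s * v) * i + (r * u * j + r * s * (u * v)) by ring.
by apply: is_idealD => //; [|apply: is_idealD => //]; apply: is_idealMl.
Qed.

Definition nonzero_ideal I := is_ideal I /\ exists2 x, x != 0 & I x.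

Lemma nonzero_idealP I : is_ideal I -> I <> [set 0] -> nonzero_ideal I.
Proof.
move=> idI I0; split=> //; apply: contrapT => nex; apply: I0.
apply/seteqP; split=> x; last by move=> ->; exact: is_ideal0.
by move=> Ix; apply: contrapT => /eqP x0; apply: nex; exists x.
Qed.

Lemma nonzero_idealI I J :
  nonzero_ideal I -> nonzero_ideal J -> nonzero_ideal (I `&` J).
Proof.
move=> [idI [x x0 Ix]] [idJ [y y0 Jy]].
split; first exact: is_ideal_setI.
exists (x * y); first by rewrite mulf_neq0.
by split; [exact: is_idealMr|exact: is_idealMl].
Qed.

Lemma is_prime_idealP P : is_prime_ideal P <->
  [/\ is_ideal P, ~ P 1 & forall u v, P (u * v) -> P u \/ P v].
Proof.
have memE x : (x \in mem P) = (P x) :> Prop by exact: in_setE.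
split=> [[[P0 P1 PM] Ppr]|[idP P1 Ppr]].
  split.
  - apply/is_idealP; split; first by rewrite -memE.
    by move=> a u v; rewrite -!memE; apply: PM.
  - by rewrite -memE; apply/negP.
  - by move=> u v; rewrite -!memE => /Ppr/orP.
split; [split|].
- by rewrite memE; exact: is_ideal0.
- by apply/negP; rewrite memE.
- move=> a u v; rewrite !memE => Pu Pv.
  by apply: is_idealD => //; apply: is_idealMl.
- by move=> u v; rewrite memE => /Ppr uv; apply/orP; rewrite !memE.
Qed.

Section Prime.
Variables (P : set R) (prP : is_prime_ideal P).

Lemma is_ideal_prime : is_ideal P.
Proof. by case/is_prime_idealP: prP. Qed.

Lemma prime_not1 : ~ P 1.
Proof. by case/is_prime_idealP: prP. Qed.

Lemma prime_notM u v : ~ P u -> ~ P v -> ~ P (u * v).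
Proof. by case/is_prime_idealP: prP => _ _ pr nu nv /pr[]. Qed.

Lemma prime_notX u n : ~ P u -> ~ P (u ^+ n).
Proof.
move=> nu; elim: n => [|n IH]; first exact: prime_not1.
by rewrite exprS; apply: prime_notM.
Qed.

Lemma prime_memX u n : P (u ^+ n) -> P u.
Proof. by apply: contraPP; apply: prime_notX. Qed.

Lemma prime_not0 u : ~ P u -> u != 0.
Proof. by apply: contra_notN => /eqP->; apply: is_ideal0 is_ideal_prime. Qed.

End Prime.

(** Finite generation makes the union of a nonempty chain of members of [C]
    equal to one of them, so that Zorn's lemma applies. *)
Lemma noetherian_maximal (noethR : noetherian R) (C : set (set R)) I0 :
  C `<=` is_ideal (R:=R) -> C I0 ->
  exists2 A, C A & forall B, C B -> A `<=` B -> B `<=` A.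
Proof.
move=> Cid CI0.
(* Zorn's lemma also asks for an upper bound of the empty chain, whose union is
   the empty set. *)
pose D : set (set R) := [set X | X = set0 \/ C X].
have [F FD totF|A [DA maxA]] := @Zorn_bigcup _ D.
  have [[Y FY [y Yy]]|F0] := pselect (exists2 Y, F Y & Y !=set0); last first.
    left; rewrite -subset0 => x [X FX Xx]; apply: F0.
    by exists X => //; exists x.
  right; set V := \bigcup_(X in F) X.
  have FC X z : F X -> X z -> C X.
    by move=> FX Xz; case: (FD _ FX) => [X0|//]; rewrite X0 in Xz.
  have Fid X z : F X -> X z -> is_ideal X by move=> FX /(FC _ _ FX)/Cid.
  have join X X' : F X -> F X' -> exists2 Z, F Z & X `<=` Z /\ X' `<=` Z.
    by move=> FX FX'; case: (totF X X' FX FX') => ?;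
      [exists X'; last split|exists X; last split].
  have idV : is_ideal V.
    apply: ideal_build.
    - by exists Y => //; exact: is_ideal0 (Fid _ _ FY Yy).
    - move=> u v [X FX Xu] [X' FX' Xv].
      have [Z FZ [sX sX']] := join _ _ FX FX'.
      exists Z => //; apply: (is_idealD (Fid _ _ FZ (sX _ Xu))).
        exact: sX.
      exact: sX'.
    - move=> a u [X FX Xu]; exists X => //.
      exact: is_idealMl (Fid _ _ FX Xu) _ _ Xu.
  have [s Vs] := noethR _ idV.
  have sV x : x \in s -> V x.
    by move=> xs; rewrite Vs => T [_]; apply.
  have [Z FZ [YZ sZ]] : exists2 Z, F Z & Y `<=` Z /\ forall x, x \in s -> Z x.
    elim: s sV {Vs} => [|x s IH] sV; first by exists Y; last split.
    have [|Z FZ [YZ sZ]] := IH.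
      by move=> z zs; apply: sV; rewrite inE zs orbT.
    have [X FX Xx] := sV x (mem_head _ _).
    have [W FW [ZW XW]] := join _ _ FZ FX.
    exists W => //; split; first exact: subset_trans YZ ZW.
    by move=> z; rewrite inE => /predU1P[->|/sZ/ZW//]; apply: XW.
  suff -> : V = Z by apply: FC FZ (YZ _ Yy).
  apply/seteqP; split; last by move=> z Zz; exists Z.
  rewrite Vs; apply: smallest_sub; first exact: Fid FZ (YZ _ Yy).
  by move=> z /sZ.
have CA : C A.
  case: DA => // A0; exfalso; apply: (maxA I0); last by right.
  rewrite A0; split; first exact: sub0set.
  by move=> /(_ 0 (is_ideal0 (Cid _ CI0))).
exists A => // B CB sAB; apply: contrapT => nBA.
by apply: (maxA B) => //; right.
Qed.

(** An ideal that is maximal among those containing [I] and disjoint from the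
    multiplicative set [M] is prime. *)
Lemma prime_avoiding (noethR : noetherian R) I (M : set R) :
  is_ideal I -> M 1 -> (forall u v, M u -> M v -> M (u * v)) ->
  (forall x, M x -> ~ I x) ->
  exists P, [/\ is_prime_ideal P, I `<=` P & forall x, M x -> ~ P x].
Proof.
move=> idI M1 MM MI.
pose C := [set J | [/\ is_ideal J, I `<=` J & forall x, M x -> ~ J x]].
have Cid : C `<=` is_ideal (R:=R) by move=> J [].
have CI : C I by split.
have [P [idP IP MP] maxP] := noetherian_maximal noethR Cid CI.
exists P; split=> //; apply/is_prime_idealP; split=> //; first exact: MP.
have meet u : ~ P u -> exists2 m, M m & adjoin P u m.
  move=> nPu; apply: contrapT => nex; apply: nPu.
  apply: (maxP (adjoin P u)); last by apply: mem_adjoin.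
    split; first exact: is_ideal_adjoin.
    - by apply: subset_trans IP _; apply: sub_adjoin.
    - by move=> x Mx ax; apply: nex; exists x.
  exact: sub_adjoin.
move=> u v Puv; apply: contrapT.
move=> /not_orP[/meet[m Mm am] /meet[n Mn an]].
by apply: (MP (m * n)); [exact: MM|exact: adjoinM am an].
Qed.

End Ideals.

(** * Comaximality and primary components *)

Section Comaximal.
Variable R : idomainType.
Implicit Types (I J P Q : set R) (a b c x y z : R).

(** [a] is a unit modulo [I]; unlike an equality of ideals, this form is
    directly multiplicative in [a]. *)
Definition comaximal a I := exists r i, I i /\ r * a + i = 1.

Lemma comaximal1 I : is_ideal I -> comaximal 1 I.
Proof. by move=> idI; exists 1, 0; split; [exact: is_ideal0|ring]. Qed.

Lemma comaximalM a b I :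
  is_ideal I -> comaximal a I -> comaximal b I -> comaximal (a * b) I.
Proof.
move=> idI [r [i [Ii ra]]] [s [j [Ij sb]]].
exists (r * s), (i + r * a * j); split.
  by apply: is_idealD => //; apply: is_idealMl.
by rewrite -[RHS]ra -[in RHS](mulr1 (r * a)) -sb; ring.
Qed.

Lemma comaximalX a n I : is_ideal I -> comaximal a I -> comaximal (a ^+ n) I.
Proof.
move=> idI aI; elim: n => [|n IH]; first exact: comaximal1.
by rewrite exprS; apply: comaximalM.
Qed.

Lemma comaximalI a I J :
  is_ideal I -> is_ideal J -> comaximal a I -> comaximal a J ->
  comaximal a (I `&` J).
Proof.
move=> idI idJ [r [i [Ii ri]]] [s [j [Jj sj]]].
exists (r + i * s), (i * j); split.
  by split; [apply: is_idealMr|apply: is_idealMl].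
by rewrite -[RHS]ri -[in RHS](mulr1 i) -sj; ring.
Qed.

Lemma ideal_span_comaximal a I : is_ideal I ->
  ideal_span (a |` I) = [set: R] <-> comaximal a I.
Proof.
move=> idI; split=> [sp|[r [i [Ii ri]]]].
  have : ideal_span (a |` I) 1 by rewrite sp.
  move=> /(_ (adjoin I a))[|i [r [Ii e]]].
    split; first exact: is_ideal_adjoin.
    by move=> x [->|Ix]; [exact: mem_adjoin|exact: sub_adjoin].
  by exists r, i; split=> //; rewrite e addrC.
rewrite -subTset => x _ J [idJ sJ].
rewrite -[x]mulr1 -ri; apply: is_idealMl => //; apply: is_idealD => //.
  by apply: is_idealMl => //; apply: sJ; left.
by apply: sJ; right.
Qed.

(** The contraction to [R] of the extension of [I] to the localization of [R]
    at [P]. In a one-dimensional noetherian domain it is the [P]-primary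
    component of a nonzero [I], and it stands in for the power of [P] in the
    factorization of [I]. *)
Definition primary_component P I : set R :=
  [set r | exists2 u, ~ P u & I (u * r)].

Lemma sub_primary_component P I :
  is_prime_ideal P -> I `<=` primary_component P I.
Proof.
by move=> prP r Ir; exists 1; [exact: prime_not1|rewrite mul1r].
Qed.

Lemma is_ideal_primary_component P I :
  is_prime_ideal P -> is_ideal I -> is_ideal (primary_component P I).
Proof.
move=> prP idI; apply: ideal_build.
- by apply: sub_primary_component => //; apply: is_ideal0.
- move=> x y [u nu Iu] [v nv Iv]; exists (u * v); first exact: prime_notM.
  have -> : u * v * (x + y) = v * (u * x) + u * (v * y) by ring.
  by apply: is_idealD => //; apply: is_idealMl.
- move=> a x [u nu Iu]; exists u => //.
  by rewrite mulrCA; apply: is_idealMl.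
Qed.

Lemma nonzero_primary_component P I :
  is_prime_ideal P -> nonzero_ideal I -> nonzero_ideal (primary_component P I).
Proof.
move=> prP [idI [x x0 Ix]]; split; first exact: is_ideal_primary_component.
by exists x => //; apply: sub_primary_component.
Qed.

(** One denominator [u] serves all elements of the component, because the
    component is finitely generated. *)
Lemma primary_component_bounded P I : noetherian R -> is_prime_ideal P ->
  is_ideal I ->
  exists2 u, ~ P u & forall r, primary_component P I r -> I (u * r).
Proof.
move=> noethR prP idI.
have idQ := is_ideal_primary_component prP idI.
have [s Qs] := noethR _ idQ.
have sQ x : x \in s -> primary_component P I x.
  by move=> xs; rewrite Qs => T [_]; apply.
have [u nu us] : exists2 u, ~ P u & forall x, x \in s -> I (u * x).
  elim: s sQ {Qs} => [|x s IH] sQ; first by exists 1; first exact: prime_not1.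
  have [|u nu us] := IH; first by move=> z zs; apply: sQ; rewrite inE zs orbT.
  have [v nv Iv] := sQ x (mem_head _ _).
  exists (u * v); first exact: prime_notM.
  move=> z; rewrite inE => /predU1P[->|/us Iz].
    by rewrite -mulrA; apply: is_idealMl.
  by rewrite mulrAC; apply: is_idealMr.
exists u => // r; rewrite Qs; move=> /(_ [set r | I (u * r)]); apply.
split; last by move=> z /us.
apply: ideal_build; rewrite /=.
- by rewrite mulr0; apply: is_ideal0.
- by move=> x y Ix Iy; rewrite mulrDr; apply: is_idealD.
- by move=> a x Ix; rewrite mulrCA; apply: is_idealMl.
Qed.

End Comaximal.

(** * One-dimensional noetherian domains *)

Section DimensionOne.
Variables (R : idomainType).
Hypotheses (noethR : noetherian R) (dimR : has_krull_dim R 1).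
Implicit Types (I J P Q : set R) (a b c x y z : R).

Lemma prime_ideal_0 : is_prime_ideal [set (0 : R)].
Proof.
apply/is_prime_idealP; split.
- apply: ideal_build => //=.
  + by move=> u v -> ->; rewrite addr0.
  + by move=> a u ->; rewrite mulr0.
- by move=> /eqP; rewrite oner_eq0.
- by move=> u v /eqP; rewrite mulf_eq0 => /orP[] /eqP; [left|right].
Qed.

(** Otherwise [0], [P] and [Q] would form a chain of length two. *)
Lemma prime_ideal_maximal P Q x : is_prime_ideal P -> is_prime_ideal Q ->
  P x -> x != 0 -> P `<=` Q -> Q `<=` P.
Proof.
move=> prP prQ Px x0 PQ; apply: contrapT => QP.
have [_ /(_ 2%N (fun i => nth Q [:: [set 0]; P] i))] := dimR.
suff ch : prime_chain 2 (fun i => nth Q [:: [set 0]; P] i) by move=> /(_ ch).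
split; first by move=> [|[|[|]]] //= _; exact: prime_ideal_0.
move=> [|[|[|]]] //= _; split=> //.
  by move=> _ ->; apply: is_ideal0 (is_ideal_prime prP).
by move=> /(_ _ Px)/eqP; rewrite (negbTE x0).
Qed.

Lemma prime_comaximal P a :
  is_prime_ideal P -> nonzero_ideal P -> ~ P a -> comaximal a P.
Proof.
move=> prP [idP [x x0 Px]] nPa; apply: contrapT => nco.
have [||||Q [prQ PQ Q1]] :=
  prime_avoiding (I := adjoin P a) (M := [set 1]) noethR.
- exact: is_ideal_adjoin.
- by [].
- by move=> u v -> ->; rewrite mulr1.
- move=> _ -> [i [r [Pi e]]]; apply: nco; exists r, i; split=> //.
  by rewrite e addrC.
apply/nPa/(prime_ideal_maximal prP prQ Px x0).
  by apply: subset_trans PQ; apply: sub_adjoin.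
by apply/PQ/mem_adjoin.
Qed.

(** In the local ring at [P] the radical of a nonzero ideal contains the maximal
    ideal: a prime over [I] that avoids every [u * p ^+ n] with [u] outside [P]
    would be nonzero and strictly smaller than [P]. *)
Lemma primary_component_pow P I p : is_prime_ideal P -> nonzero_ideal I ->
  P p -> exists n, primary_component P I (p ^+ n).
Proof.
move=> prP [idI [x x0 Ix]] Pp; apply: contrapT => nex.
pose M := [set m | exists u n, ~ P u /\ m = u * p ^+ n].
have [||||Q [prQ IQ QM]] := prime_avoiding (I := I) (M := M) noethR.
- by [].
- by exists 1, 0%N; split; [exact: prime_not1|rewrite mulr1].
- move=> _ _ [u [n [nu ->]]] [v [m [nv ->]]]; exists (u * v), (n + m)%N.
  by split; [exact: prime_notM|rewrite exprD; ring].
- by move=> _ [u [n [nu ->]]] Iu; apply: nex; exists n; exists u.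
have QP : Q `<=` P.
  move=> q Qq; apply: contrapT => nPq; apply: (QM q) Qq.
  by exists q, 0%N; rewrite mulr1.
apply: (QM p); last exact: (prime_ideal_maximal prQ prP (IQ _ Ix) x0 QP).
by exists 1, 1%N; rewrite mul1r; split=> //; exact: prime_not1.
Qed.

(** [P] is the only prime over its component: if [w * s + p = 1] with [p] in
    [P], then a power of [p] lies in the component, and [p] is a unit modulo
    [s]. *)
Lemma primary_component_comaximal P I s : is_prime_ideal P ->
  nonzero_ideal P -> nonzero_ideal I -> ~ P s ->
  comaximal s (primary_component P I).
Proof.
move=> prP nzP nzI nPs.
have [w [p [Pp wp]]] := prime_comaximal prP nzP nPs.
have [n pn] := primary_component_pow prP nzI Pp.
have idQ := is_ideal_primary_component prP nzI.1.
have : comaximal p (multiples s).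
  by exists 1, (w * s); split; [exists w|rewrite mul1r addrC].
move=> /(comaximalX n (is_ideal_multiples s))[r [_ [[t ->] e]]].
by exists t, (r * p ^+ n); split; [exact: is_idealMl|rewrite addrC].
Qed.

(** The [P]-primary component of the multiples of [d * t], with [t] in [P],
    misses [d]: if [u * d] is a multiple of [d * t], then [u] is a multiple of
    [t], hence lies in [P]. *)
Lemma separating_primary_ideal P d :
  is_prime_ideal P -> nonzero_ideal P -> d != 0 ->
  exists Q, [/\ nonzero_ideal Q, Q `<=` P, ~ Q d
    & forall s, ~ P s -> comaximal s Q].
Proof.
move=> prP nzP d0; have [idP [t t0 Pt]] := nzP.
have nzdt : nonzero_ideal (multiples (d * t)).
  split; first exact: is_ideal_multiples.
  by exists (d * t); [rewrite mulf_neq0|exists 1; rewrite mul1r].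
exists (primary_component P (multiples (d * t))); split.
- exact: nonzero_primary_component.
- move=> r [u nu [v e]]; apply: contrapT => nr.
  apply: (prime_notM prP nu nr); rewrite e mulrA.
  exact: is_idealMl.
- move=> [u nu [r e]]; apply: nu.
  suff -> : u = r * t by apply: is_idealMl.
  by apply: (mulIf d0); rewrite e; ring.
- by move=> s nPs; apply: primary_component_comaximal.
Qed.

End DimensionOne.

(** * Cosets and their closures in the Golomb space *)

Section GolombTopology.
Variable R : idomainType.
Implicit Types (x : R) (I L Q : set R) (c z : golomb R) (W : set (golomb R)).

Definition golomb_of x (x0 : x != 0) : golomb R :=
  exist (fun x : R => x != 0) x x0.

Definition golomb_coset c I : set (golomb R) := [set z | I (val z - val c)].

Lemma golomb_cosetE c I z : golomb_coset c I z = I (val z - val c).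
Proof. by []. Qed.

Lemma golomb_coset_subbase c I : nonzero_ideal I -> comaximal (val c) I ->
  golomb_subbase (golomb_coset c I).
Proof.
move=> [idI [x x0 Ix]] cI; exists (val c), I; split=> //.
- by apply/eqP => I0; rewrite I0 in Ix; rewrite Ix eqxx in x0.
- exact/ideal_span_comaximal.
- apply/seteqP; split=> z.
    move=> Iz; apply/mem_set; exists (val z - val c) => //.
    by rewrite addrC subrK.
  move=> /set_mem[i Ii e]; rewrite golomb_cosetE [X in I X](_ : _ = i) //.
  by rewrite -e addrAC subrr add0r.
Qed.

Lemma open_golomb_coset c I : nonzero_ideal I -> comaximal (val c) I ->
  open (golomb_coset c I).
Proof.
move=> nzI cI; exists [set golomb_coset c I]; last by rewrite bigcup_set1.
move=> _ ->; apply: (@finI_from1 _ _ (@golomb_subbase R) id).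
exact: golomb_coset_subbase.
Qed.

Lemma golomb_coset_center c I : is_ideal I -> golomb_coset c I c.
Proof. by move=> idI; rewrite golomb_cosetE subrr; apply: is_ideal0. Qed.

(** The neighborhood filter of [c], described by its base of cosets; being a
    filter, it absorbs the finite intersections of subbasic sets. *)
Definition contains_coset c : set_system (golomb R) :=
  [set B | exists I,
    [/\ nonzero_ideal I, comaximal (val c) I & golomb_coset c I `<=` B]].

Lemma contains_coset_filter c : Filter (contains_coset c).
Proof.
split.
- exists setT; split=> //; last by exists 0, 1; split=> //; ring.
  by split; [exact: ideal_build|exists 1; rewrite ?oner_neq0].
- move=> A B [I [nzI cI sI]] [J [nzJ cJ sJ]]; exists (I `&` J); split.
  + exact: nonzero_idealI.
  + by apply: comaximalI => //; [case: nzI|case: nzJ].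
  + by move=> z [Iz Jz]; split; [exact: sI|exact: sJ].
- move=> A B AB [I [nzI cI sI]]; exists I; split=> //.
  exact: subset_trans sI AB.
Qed.

Lemma golomb_subbase_coset c W : golomb_subbase W -> W c -> contains_coset c W.
Proof.
move=> [a [I [idI I0 /(ideal_span_comaximal _ idI) aI ->]]] /set_mem[i Ii ai].
exists I; split.
- by apply: nonzero_idealP => //; exact/eqP.
- have [r [j [Ij e]]] := aI; exists r, (j - r * i); split.
    by apply: is_idealB => //; apply: is_idealMl.
  by rewrite -ai -e; ring.
- move=> z Iz; apply/mem_set; exists (i + (val z - val c)).
    exact: is_idealD.
  by rewrite -ai; ring.
Qed.

Lemma open_golomb_contains_coset W c : open W -> W c -> contains_coset c W.
Proof.
have cF := contains_coset_filter c.
move=> [D fD <-] [V DV Vc]; have [E sE eV] := fD _ DV.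
apply: (filterS (bigcup_sup DV)); rewrite -eV; apply: filter_bigI => U UE.
apply: golomb_subbase_coset; first by have := sE _ UE; rewrite in_setE.
by move: Vc; rewrite -eV; apply.
Qed.

(** Every neighborhood of [z] contains a coset [z + L], and the hypothesis
    makes [z + L] meet [c + I] in the whole ring. *)
Lemma closure_coset_sup c I z : nonzero_ideal I ->
  (forall L, nonzero_ideal L -> comaximal (val z) L ->
     exists i l, [/\ I i, L l & val z - val c = i + l]) ->
  closure (golomb_coset c I) z.
Proof.
move=> [idI [x x0 Ix]] zI B; rewrite nbhsE => -[U [oU Uz] UB].
have [L [nzL zL LU]] := open_golomb_contains_coset oU Uz.
have [i [l [Ii Ll e]]] := zI L nzL zL; have [idL [y y0 Ly]] := nzL.
(* A shift by an element of [I] and [L] moves the common point away from 0. *)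
suff [k [Ik Lk k0]] : exists k, [/\ I k, L k & val c + i + k != 0].
  have [w we] : exists w : golomb R, val w = val c + i + k.
    by exists (golomb_of k0).
  exists w; split; last apply/UB/LU; rewrite golomb_cosetE we.
    by rewrite [X in I X](_ : _ = i + k); [exact: is_idealD|ring].
  rewrite [X in L X](_ : _ = k - l); first exact: is_idealB.
  have -> : i = val z - val c - l by rewrite e addrK.
  by ring.
have [ci0|ci] := eqVneq (val c + i) 0; last first.
  by exists 0; split; rewrite ?addr0 //; exact: is_ideal0.
exists (x * y); split; [exact: is_idealMr|exact: is_idealMl|].
by rewrite ci0 add0r mulf_neq0.
Qed.

(** The closure of a coset of [I] contains the nonzero elements of the radical
    of [I]: if a power of [z] lies in [I], any [L] comaximal to [z] is comaximal
    to [I]. *)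
Lemma closure_open_sup W c : open W -> W c ->
  exists I, [/\ nonzero_ideal I, comaximal (val c) I
    & forall z n, I (val z ^+ n) -> closure W z].
Proof.
move=> oW Wc; have [I [nzI cI IW]] := open_golomb_contains_coset oW Wc.
exists I; split=> // z n Izn; apply: (closure_subset IW).
apply: closure_coset_sup => // L [idL _] /(comaximalX n idL)[r [l [Ll e]]].
have [idI _] := nzI.
exists ((val z - val c) * (r * val z ^+ n)), ((val z - val c) * l); split.
- by rewrite mulrA; apply: is_idealMl.
- exact: is_idealMl.
- by rewrite -mulrDr e mulr1.
Qed.

(** If [z + Q] is a neighborhood of [z], it must meet [c + Q]. *)
Lemma closure_coset_sub c Q z : nonzero_ideal Q -> comaximal (val z) Q ->
  closure (golomb_coset c Q) z -> Q (val z - val c).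
Proof.
move=> nzQ zQ clz; have [idQ _] := nzQ.
have [|w [cw zw]] := clz (golomb_coset z Q).
  apply: open_nbhs_nbhs; split; first exact: open_golomb_coset.
  exact: golomb_coset_center.
have -> : val z - val c = (val w - val c) - (val w - val z) by ring.
exact: is_idealB.
Qed.

End GolombTopology.

(** * A topological relation between points *)

Section Invariants.

(** The closures of the open sets meeting [A] generate the same filter as the
    closures of all nonempty open sets. *)
Definition closure_generating (T : topologicalType) (A : set T) : Prop :=
  forall F : set_system T, Filter F ->
    (forall W, open W -> W `&` A !=set0 -> F (closure W)) ->
    forall U, open U -> U !=set0 -> F (closure U).

(** [A] must avoid [x]: if [x] belonged to [A], replacing [y] by [x] could lower
    the number of points. *)
Definition replaceable (T : topologicalType) (x y : T) : Prop :=
  forall A : set T, ~ A x ->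
    closure_generating (y |` A) -> closure_generating (x |` A).

Lemma closure_preimage (T U : topologicalType) (f : T -> U) (g : U -> T) B :
  cancel f g -> cancel g f -> continuous f -> continuous g ->
  closure (g @^-1` B) = g @^-1` (closure B).
Proof.
move=> fK gK cf cg; apply/seteqP; split=> u clu V nV.
  have [|w [Bw Vw]] := clu (g @^-1` V); first exact: cg.
  by exists (g w).
have [|w [Bw Vw]] := clu (f @^-1` V).
  by apply: cf; rewrite gK.
by exists (f w); split=> //; rewrite /= fK.
Qed.

Lemma closure_generating_homeo (T U : topologicalType) (f : T -> U)
  (g : U -> T) A : cancel f g -> cancel g f -> continuous f -> continuous g ->
  closure_generating A -> closure_generating (g @^-1` A).
Proof.
move=> fK gK cf cg genA F FF FA V oV [v Vv].
have FgF : Filter [set B | F (g @^-1` B)] by exact: (fmap_filter g).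
have -> : closure V = g @^-1` closure (f @^-1` V).
  rewrite (closure_preimage _ gK fK) //.
  by apply/seteqP; split=> w /=; rewrite gK.
change ([set B | F (g @^-1` B)] (closure (f @^-1` V))).
apply: (genA _ FgF) => [W oW [w [Ww Aw]]||].
- rewrite /= -(closure_preimage _ fK gK) //; apply: FA.
    by move/continuousP: cg; apply.
  by exists (f w); rewrite /= fK.
- by move/continuousP: cf; apply.
- by exists (g v); rewrite /= gK.
Qed.

Lemma replaceable_homeo (T U : topologicalType) (f : T -> U) (g : U -> T) x y :
  cancel f g -> cancel g f -> continuous f -> continuous g ->
  replaceable x y -> replaceable (f x) (f y).
Proof.
move=> fK gK cf cg rep A nAx genA.
have pre z : f @^-1` (f z |` A) = z |` (f @^-1` A).
  apply/seteqP; split=> w /= [|]; [|by right| |by right].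
    by move=> /(can_inj fK)->; left.
  by move=> ->; left.
have -> : f x |` A = g @^-1` (x |` (f @^-1` A)).
  by rewrite -pre; apply/seteqP; split=> w /=; rewrite gK.
apply: (closure_generating_homeo fK gK cf cg).
apply: rep => //; rewrite -pre; exact: (closure_generating_homeo gK fK cg cf).
Qed.

End Invariants.

(** * Closures and prime ideals *)

Section GolombGenerating.
Variables (R : idomainType).
Hypotheses (noethR : noetherian R) (dimR : has_krull_dim R 1).
Implicit Types (I L P Q : set R) (a c x y z : golomb R) (A : set (golomb R)).

(** If [a] and [b] lie outside [P] and [Q] is a [P]-primary ideal missing
    [a - b], the closures of [a + Q] and [b + Q] meet inside [P]; hence every
    nonzero prime ideal belongs to the filter. Noetherian induction then puts
    every nonzero radical ideal in the filter, and the closure of a nonempty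
    open set contains such an ideal. *)
Lemma generating_of_two_outside A :
  (forall P, is_prime_ideal P -> nonzero_ideal P -> exists a b,
     [/\ A a, A b, a <> b, ~ P (val a) & ~ P (val b)]) ->
  closure_generating A.
Proof.
move=> two F FF FA U oU [c Uc].
have [I [nzI cI IU]] := closure_open_sup oU Uc.
pose rad I : set (golomb R) := [set z | exists n, I (val z ^+ n)].
suff : F (rad I) by apply: filterS => z [n]; exact: IU.
apply: contrapT => nFI.
(* [P] will be a largest ideal whose radical is not in the filter. *)
pose C := [set J | nonzero_ideal J /\ ~ F (rad J)].
have Cid : C `<=` is_ideal (R:=R) by move=> J [[]].
have CI : C I by [].
have [P [[idP [t t0 Pt]] nFP] maxP] := noetherian_maximal noethR Cid CI.
have Fbig u : ~ P u -> F (rad (adjoin P u)).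
  move=> nPu; apply: contrapT => nFu; apply: nPu.
  have sP := @sub_adjoin _ _ u idP.
  apply: (maxP (adjoin P u)) => //; last exact: mem_adjoin.
  split=> //; split; first exact: is_ideal_adjoin.
  by exists t => //; apply: sP.
(* If [u * v] is in [P], the radicals of [P + (u)] and [P + (v)] intersect in
   the radical of [P]. *)
have prP : is_prime_ideal P.
  apply/is_prime_idealP; split=> //.
    move=> P1; apply: nFP; apply: (filterS _ (filterT : F setT)) => z _.
    by exists 0%N.
  move=> u v Puv; apply: contrapT => /not_orP[nu nv]; apply: nFP.
  have Fuv : F (rad (adjoin P u) `&` rad (adjoin P v)).
    by apply: filterI; apply: Fbig.
  apply: filterS Fuv => z [[n zn] [m zm]].
  by exists (n + m)%N; rewrite exprD; apply: adjoinM zn zm.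
have nzP : nonzero_ideal P by split=> //; exists t.
have [a [b [Aa Ab ab nPa nPb]]] := two P prP nzP.
have d0 : val a - val b != 0 by rewrite subr_eq0; apply/eqP => /val_inj.
have [Q [nzQ QP nQd cQ]] := separating_primary_ideal noethR dimR prP nzP d0.
have Fcl e : A e -> ~ P (val e) -> F (closure (golomb_coset e Q)).
  move=> Ae nPe; apply: FA; first exact: open_golomb_coset nzQ (cQ _ nPe).
  by exists e; split=> //; apply: golomb_coset_center nzQ.1.
have Fab := @filterI _ F FF _ _ (Fcl a Aa nPa) (Fcl b Ab nPb).
apply: nFP; apply: filterS Fab => z [za zb].
exists 1%N; rewrite expr1; apply: contrapT => nPz; apply: nQd.
have -> : val a - val b = (val z - val b) - (val z - val a) by ring.
by apply: (is_idealB nzQ.1); apply: closure_coset_sub => //; apply: cQ.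
Qed.

(** Suppose that [a] is the only point of [A] outside [P]. The sets
    [(a + I_P) & sR], where [I_P] is the [P]-primary component of a nonzero [I]
    and [s] is outside [P], generate a filter that contains the closure of every
    open set meeting [A]: such a set contains either some [a + I], and some [s]
    outside [P] satisfies [s * I_P <= I], or some [c + I] with [c] in [P], and
    then [I] itself has an element [s] outside [P]. With
    [t] in [P] and [Q] a [P]-primary ideal missing [t], the closure of
    [a + t + Q] is not in this filter, as it has no point of [a + Q] outside
    [P]. *)
Lemma two_outside_of_generating A P : closure_generating A ->
  is_prime_ideal P -> nonzero_ideal P -> exists a b,
     [/\ A a, A b, a <> b, ~ P (val a) & ~ P (val b)].
Proof.
move=> genA prP nzP; apply: contrapT => none.
have [a [nPa Aa]] : exists a, ~ P (val a) /\
    forall b, A b -> ~ P (val b) -> b = a.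
  have [[a Aa nPa]|no] := pselect (exists2 a, A a & ~ P (val a)).
    exists a; split=> // b Ab nPb; apply: contrapT => ba; apply: none.
    by exists b, a.
  exists (golomb_of (oner_neq0 R)); split.
    exact: prime_not1.
  by move=> b Ab nPb; case: no; exists b.
pose F : set_system (golomb R) := [set B | exists I s, [/\ nonzero_ideal I,
  ~ P s & forall z, primary_component P I (val z - val a) ->
    multiples s (val z) -> B z]].
have FF : Filter F.
  split.
  - by exists P, 1; split=> //; exact: prime_not1.
  - move=> B B' [I [s [nzI ns IB]]] [I' [s' [nzI' ns' IB']]].
    exists (I `&` I'), (s * s'); split; first exact: nonzero_idealI.
      exact: prime_notM.
    move=> z [u nu [Iu I'u]] [r e]; split.
      by apply: IB; [exists u|exists (r * s'); rewrite e; ring].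
    by apply: IB'; [exists u|exists (r * s); rewrite e; ring].
  - move=> B B' BB' [I [s [nzI ns IB]]]; exists I, s; split=> // z Iz sz.
    by apply/BB'/IB.
have FA W : open W -> W `&` A !=set0 -> F (closure W).
  move=> oW [c [Wc Ac]].
  have [Pc|nPc] := pselect (P (val c)).
    have [I [[idI nzI] [r [i [Ii e]]] IW]] := closure_open_sup oW Wc.
    exists P, i; split=> //.
      move=> Pi; apply: (prime_not1 prP); rewrite -e.
      by apply: is_idealD => //; [exact: nzP.1|apply: is_idealMl nzP.1 _ _ Pc].
    move=> z _ [t e']; apply: (IW z 1%N).
    by rewrite expr1 e'; apply: is_idealMl.
  have Wa : W a by rewrite -(Aa c).
  have [I [nzI aI IW]] := open_golomb_contains_coset oW Wa.
  have [idI _] := nzI.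
  have [s ns sI] := primary_component_bounded noethR prP idI.
  exists I, s; split=> // z Iz [t e]; apply: (closure_subset IW).
  apply: closure_coset_sup => // L [idL _] [r [l [Ll e1]]].
  exists (r * t * (s * (val z - val a))), (l * (val z - val a)); split.
  - by apply: is_idealMl => //; apply: sI.
  - exact: is_idealMr.
  - by rewrite -[LHS]mul1r -e1 e; ring.
have [idP [t t0 Pt]] := nzP.
have nPb : ~ P (val a + t).
  by move=> Pat; apply: nPa; rewrite -(addrK t (val a)); apply: is_idealB.
pose b : golomb R := golomb_of (prime_not0 prP nPb).
have [Q [nzQ QP nQt cQ]] := separating_primary_ideal noethR dimR prP nzP t0.
have [idQ _] := nzQ.
have [||I [s [nzI ns sub]]] := genA F FF FA (golomb_coset b Q).
- by apply: open_golomb_coset => //; apply: cQ.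
- by exists b; apply: golomb_coset_center.
(* By the Chinese remainder theorem [z := a * r * s] is a multiple of [s] that
   is congruent to [a] modulo both [I_P] and [Q]. *)
have [r [q [[Iq Qq] e]]] : comaximal s (primary_component P I `&` Q).
  apply: comaximalI => //; [|exact: primary_component_comaximal|exact: cQ].
  by apply: is_ideal_primary_component => //; case: nzI.
have za : val a * (r * s) - val a = - (val a * q).
  by rewrite -[X in _ - X]mulr1 -e; ring.
have nPz : ~ P (val a * (r * s)).
  move=> Pz; apply: nPa.
  have -> : val a = val a * (r * s) - (val a * (r * s) - val a) by ring.
  rewrite za; apply: is_idealB => //; apply: is_idealN => //.
  by apply: is_idealMl => //; apply: QP.
pose z : golomb R := golomb_of (prime_not0 prP nPz).
have clz : closure (golomb_coset b Q) z.
  apply: sub; last by exists (val a * r); rewrite /= mulrA.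
  rewrite [X in primary_component _ _ X]za.
  have idc := is_ideal_primary_component prP nzI.1.
  by apply: (is_idealN idc); apply: (is_idealMl idc).
have Qz := @closure_coset_sub _ b Q z nzQ (cQ _ nPz) clz.
apply: nQt; rewrite (_ : t = (val a * (r * s) - val a)
  - (val a * (r * s) - (val a + t))); last by ring.
apply: is_idealB => //; rewrite za.
by apply: is_idealN => //; apply: is_idealMl.
Qed.

(** If [x] is in [P] and [y] is not, take for [A] the elements of [P] other than
    [x], together with one point [z] outside [P]: adjoining [y] gives a second
    point outside [P], adjoining [x] does not, and every other prime leaves
    out enough of [P]. *)
Lemma replaceableP x y :
  replaceable x y <-> (forall P, is_prime_ideal P -> P (val x) -> P (val y)).
Proof.
split=> [rep P prP Px|sub A nAx genA].
  apply: contrapT => nPy.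
  have nzP : nonzero_ideal P.
    by split; [exact: is_ideal_prime|exists (val x); [exact: (valP x)|]].
  have [idP _] := nzP.
  have nPz : ~ P (val y + val x).
    move=> Pz; apply: nPy; rewrite -(addrK (val x) (val y)).
    exact: is_idealB.
  pose z : golomb R := golomb_of (prime_not0 prP nPz).
  pose A : set (golomb R) := [set w | w = z \/ (P (val w) /\ w <> x)].
  have nAx : ~ A x by move=> [xz|[]//]; apply: (nPz); move: (Px); rewrite xz.
  have genA : closure_generating (y |` A).
    apply: generating_of_two_outside => Q prQ nzQ.
    have [PQ|/nonsubset[p0 [Pp0 nQp0]]] := pselect (P `<=` Q).
      have QP := prime_ideal_maximal dimR prP prQ Px (valP x) PQ.
      exists y, z.
      split; [by left|by right; left| |by move=> /QP|by move=> /QP].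
      move=> /(congr1 val) /= /eqP; rewrite -subr_eq0 opprD addrA subrr add0r.
      by rewrite oppr_eq0 (negbTE (valP x)).
    (* Of all powers of the nonunit [p], at most the first can equal [x]; so
       [p ^+ 2] and [p ^+ 3] are in [A]. *)
    have [p [Pp nQp px]] : exists p, [/\ P p, ~ Q p &
        forall n, p ^+ n.+2 != val x].
      have [Qx|nQx] := pselect (Q (val x)).
        exists p0; split=> // n; apply: contra_notN (nQp0) => /eqP e.
        by apply: (prime_memX prQ (n := n.+2)); rewrite e.
      exists (val x); split=> // n; apply/eqP => e; apply: (prime_not1 prP).
      suff <- : val x ^+ n.+1 = 1 by rewrite exprS; apply: (is_idealMr idP).
      by apply: (mulIf (valP x)); rewrite -exprSr mul1r.
    have pN0 := prime_not0 prQ nQp.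
    have pX0 n : p ^+ n != 0 by rewrite expf_neq0.
    pose w n : golomb R := golomb_of (pX0 n).
    have Aw n : A (w n.+2).
      right; split; first by rewrite /= exprS; apply: is_idealMr.
      by move=> e; have := px n; rewrite -e eqxx.
    exists (w 2%N), (w 3%N).
    have nQw n : ~ Q (val (w n)) by exact: (@prime_notX _ Q prQ p n nQp).
    split=> //; [by right|by right|].
    move=> /(congr1 val) /= e; apply: (prime_not1 prP).
    suff -> : 1 = p by [].
    by apply: (mulIf (pX0 2%N)); rewrite mul1r -exprS.
  have [a [b [Aa Ab ab nPa nPb]]] :=
    two_outside_of_generating (rep A nAx genA) prP nzP.
  have out c : (x |` A) c -> ~ P (val c) -> c = z by move=> [->|[|[]]].
  by apply: ab; rewrite (out a) // (out b).
apply: generating_of_two_outside => P prP nzP.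
have [a [b [Aa Ab ab nPa nPb]]] := two_outside_of_generating genA prP nzP.
wlog Aa' : a b Aa Ab ab nPa nPb / A b.
  move=> wl; case: (Ab) => [by_|]; last exact: (wl a b).
  case: (Aa) => [ay|Aa']; first by case: ab; rewrite ay by_.
  by apply: (wl b a) => //; exact/nesym.
case: Aa => [ay|Aa]; last by exists a, b; split=> //; right.
exists x, b; split=> //; [by left|by right|by move=> xb; rewrite xb in nAx|].
by move=> /(sub P prP); rewrite -ay.
Qed.

End GolombGenerating.

(** * Radical ideals and torsion of the class group *)

Section PrimeHull.
Variable R : idomainType.
Implicit Types (I J P Q : set R) (x y : R).

(** The radical of the principal ideal of [x], described by the primes over
    it. *)
Definition prime_hull x : set R :=
  [set y | forall P, is_prime_ideal P -> P x -> P y].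

Lemma is_radical_ideal_prime_hull x : is_radical_ideal (prime_hull x).
Proof.
split.
  apply: ideal_build => [P prP _|u v hu hv P prP Px|a u hu P prP Px].
  - exact: is_ideal0 (is_ideal_prime prP).
  - by apply: (is_idealD (is_ideal_prime prP)); [exact: hu|exact: hv].
  - by apply: (is_idealMl (is_ideal_prime prP)); exact: hu.
apply/seteqP; split=> y.
  move=> [n n0 /set_mem yn] P prP Px.
  exact: (prime_memX prP (yn P prP Px)).
by move=> hy; exists 1%N => //; apply/mem_set; rewrite expr1.
Qed.

Lemma is_radical_ideal_prime P : is_prime_ideal P -> is_radical_ideal P.
Proof.
move=> prP; split; first exact: is_ideal_prime.
apply/seteqP; split=> y; first by move=> [n _ /set_mem/(prime_memX prP)].
by move=> Py; exists 1%N => //; apply/mem_set; rewrite expr1.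
Qed.

Lemma frac_mul_sub I (K : set {fraction R}) : is_ideal I ->
  K `<=` range (@tofrac R) ->
  frac_mul (@tofrac R @` I) K `<=` @tofrac R @` I.
Proof.
move=> idI KR x [s sP ->].
elim: s sP => [|p s IH] sP.
  by rewrite big_nil; exists 0; [exact: is_ideal0|rewrite tofrac0].
rewrite big_cons.
have [|i Ii <-] := IH; first by move=> q qs; apply: sP; rewrite inE qs orbT.
have [/set_mem[a Ia <-] /set_mem Kp] := sP p (mem_head _ _).
have [b _ <-] := KR _ Kp.
exists (a * b + i); first by apply: is_idealD => //; apply: is_idealMr.
by rewrite tofracD tofracM.
Qed.

Lemma frac_exp_range I n : is_ideal I ->
  frac_exp (@tofrac R @` I) n `<=` range (@tofrac R).
Proof.
move=> idI; elim: n => [//|n IH].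
apply: subset_trans (frac_mul_sub idI IH) _.
by move=> _ [a _ <-]; exists a.
Qed.

Lemma frac_exp_power I n y : I y ->
  frac_exp (@tofrac R @` I) n (tofrac (y ^+ n)).
Proof.
move=> Iy; elim: n => [|n IH]; first by exists (y ^+ 0).
exists [:: (tofrac y, tofrac (y ^+ n))].
  move=> p; rewrite mem_seq1 => /eqP->; split; apply/mem_set => //=.
  by exists y.
by rewrite big_seq1 /= exprS tofracM.
Qed.

(** A generator [x] of a principal power of [I] lies in the same primes as
    [I]. *)
Lemma torsion_generator I : torsion_class_group R -> nonzero_ideal I ->
  exists x, [/\ x != 0, I x & forall P, is_prime_ideal P -> P x -> I `<=` P].
Proof.
move=> torR [idI [z z0 Iz]].
have [|[//|n] _ [x x0 Ex]] := torR (@tofrac R @` I).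
  split.
  - by apply/mem_set; exists 0; [exact: is_ideal0|rewrite tofrac0].
  - move=> a u v /set_mem[i Ii <-] /set_mem[j Ij <-]; apply/mem_set.
    exists (a * i + j); last by rewrite tofracD tofracM.
    by apply: is_idealD => //; apply: is_idealMl.
  - exists 1; first exact: oner_neq0.
    by move=> u /set_mem[i Ii <-]; exists i; rewrite tofrac1 mul1r.
  - exists (tofrac z); first by apply/mem_set; exists z.
    by rewrite tofrac_eq0.
have [y Iy yx] : (@tofrac R @` I) x.
  apply: (frac_mul_sub idI (@frac_exp_range I n idI)).
  change (frac_exp (@tofrac R @` I) n.+1 x).
  by rewrite Ex; exists 1 => //; rewrite tofrac1 mul1r.
exists y; split=> //; first by rewrite -tofrac_eq0 yx.
move=> P prP Py w Iw.
have := frac_exp_power n.+1 Iw; rewrite Ex => -[a _].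
rewrite -yx -tofracM => /eqP; rewrite tofrac_eq => /eqP e.
apply: (prime_memX prP (n := n.+1)); rewrite -e.
exact: is_idealMl (is_ideal_prime prP) _ _ Py.
Qed.

Lemma radical_ideal_prime_hull I : noetherian R -> torsion_class_group R ->
  is_radical_ideal I -> I <> [set 0] ->
  exists2 x, x != 0 & I = prime_hull x.
Proof.
move=> noethR torR [idI radI] I0.
have [x [x0 Ix xI]] := torsion_generator torR (nonzero_idealP idI I0).
exists x => //; apply/seteqP; split=> y.
  by move=> Iy P prP /(xI P prP); apply.
move=> hy; apply: contrapT => nIy.
have [||||P [prP IP MP]] := prime_avoiding (I := I)
  (M := [set m | exists n, m = y ^+ n]) noethR.
- by [].
- by exists 0%N.
- by move=> _ _ [n ->] [m ->]; exists (n + m)%N; rewrite exprD.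
- move=> _ [[|n] ->] Iyn; apply: nIy.
    by rewrite -[y]mulr1; apply: is_idealMl.
  by rewrite -radI; exists n.+1 => //; apply/mem_set.
apply: (MP y); first by exists 1%N.
by apply: hy => //; apply: IP.
Qed.

End PrimeHull.

(** * Images of ideals under a homeomorphism *)

Section Extension.

Lemma can_image (T U : Type) (e : T -> U) (e' : U -> T) (A : set T) :
  cancel e e' -> e' @` (e @` A) = A.
Proof.
move=> eK; rewrite -[RHS]image_id image_comp.
by apply: eq_imagel => x _; exact: eK.
Qed.

Lemma golomb_ext0 (R S : idomainType) (h : golomb R -> golomb S) :
  golomb_ext h 0 = 0.
Proof. by rewrite /golomb_ext insubF ?eqxx. Qed.

Lemma golomb_ext_val (R S : idomainType) (h : golomb R -> golomb S) u :
  golomb_ext h (val u) = val (h u).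
Proof. by rewrite /golomb_ext valK. Qed.

Variant golomb_spec (R : idomainType) : R -> Prop :=
  | GolombZero : golomb_spec 0
  | GolombVal (u : golomb R) : golomb_spec (val u).

Lemma golombP (R : idomainType) (x : R) : golomb_spec x.
Proof.
have [->|x0] := eqVneq x 0; first exact: GolombZero.
exact: (GolombVal (golomb_of x0)).
Qed.

Lemma golomb_extK (R S : idomainType) (h : golomb R -> golomb S) g :
  cancel h g -> cancel (golomb_ext h) (golomb_ext g).
Proof.
by move=> hK x; case: (golombP x) => [|u];
  [rewrite !golomb_ext0|rewrite !golomb_ext_val hK].
Qed.

End Extension.

Section Homeomorphism.
Variables (R S : idomainType).
Hypotheses (dedR : dedekind R) (dedS : dedekind S).
Hypothesis (torR : torsion_class_group R).
Variables (h : golomb R -> golomb S) (g : golomb S -> golomb R).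
Hypotheses (hK : cancel h g) (gK : cancel g h).
Hypotheses (ch : continuous h) (cg : continuous g).

(** By [replaceableP], lying in all the primes that contain [x] is a topological
    relation to [x]. *)
Lemma golomb_ext_prime_hull x :
  golomb_ext h @` prime_hull (val x) = prime_hull (val (h x)).
Proof.
have [noethR _ dimR] := dedR; have [noethS _ dimS] := dedS.
have repP (u v : golomb R) : replaceable u v <-> prime_hull (val u) (val v).
  exact: replaceableP.
have repP' (u v : golomb S) : replaceable u v <-> prime_hull (val u) (val v).
  exact: replaceableP.
have hull0 (T : idomainType) (y : T) : prime_hull y 0.
  by move=> P prP _; apply: is_ideal0 (is_ideal_prime prP).
apply/seteqP; split=> y.
  move=> [z + <-]; case: (golombP z) => [_|u xu]; first by rewrite golomb_ext0.
  rewrite golomb_ext_val; apply/repP'; move/repP: xu.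
  exact: replaceable_homeo hK gK ch cg.
case: (golombP y) => [_|u /repP' hxu]; first by exists 0; rewrite ?golomb_ext0.
exists (val (g u)); last by rewrite golomb_ext_val gK.
by apply/repP; rewrite -[x]hK; apply: (replaceable_homeo gK hK cg ch).
Qed.

Lemma image_golomb_ext0 : golomb_ext h @` [set 0] = [set 0].
Proof. by rewrite image_set1 golomb_ext0. Qed.

Lemma is_radical_ideal_image I : is_radical_ideal I ->
  is_radical_ideal (golomb_ext h @` I).
Proof.
move=> radI; have [->|I0] := pselect (I = [set 0]).
  rewrite image_golomb_ext0; apply: is_radical_ideal_prime.
  exact: prime_ideal_0.
have [noethR _ _] := dedR.
have [x x0 ->] := radical_ideal_prime_hull noethR torR radI I0.
rewrite -[x]/(val (golomb_of x0)).
by rewrite golomb_ext_prime_hull; apply: is_radical_ideal_prime_hull.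
Qed.

End Homeomorphism.

(** The image of [P] is proper, so a prime [Q] contains it. The preimage of [Q]
    is a proper ideal containing [P], hence equals [P] by maximality, and the
    image of [P] is [Q]. *)
Lemma is_prime_ideal_image (R S : idomainType) (h : golomb R -> golomb S) g
  (P : set R) :
  dedekind R -> dedekind S -> torsion_class_group R -> torsion_class_group S ->
  cancel h g -> cancel g h -> continuous h -> continuous g ->
  is_prime_ideal P -> is_prime_ideal (golomb_ext h @` P).
Proof.
move=> dedR dedS torR torS hK gK ch cg prP.
have [noethR _ dimR] := dedR; have [noethS _ dimS] := dedS.
have [->|P0] := pselect (P = [set 0]).
  by rewrite image_golomb_ext0; apply: prime_ideal_0.
have eK := golomb_extK hK; have eK' := golomb_extK gK.
have radP := is_radical_ideal_prime prP.
have [x x0 Px] := radical_ideal_prime_hull noethR torR radP P0.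
have imE := golomb_ext_prime_hull dedR dedS hK gK ch cg (golomb_of x0).
rewrite Px imE.
set y := h _ in imE *.
have [Q [prQ Qy]] : exists Q, is_prime_ideal Q /\ Q (val y).
  apply: contrapT => none; apply: (prime_not1 prP).
  have : prime_hull (val y) (golomb_ext h 1).
    by move=> Q prQ Qy; case: none; exists Q.
  by rewrite -imE => -[z Pz /(can_inj eK) <-]; rewrite Px.
have radQ := is_radical_ideal_prime prQ.
have [idJ _] := is_radical_ideal_image dedS dedR torS gK hK cg ch radQ.
have PJ : P `<=` golomb_ext g @` Q.
  rewrite Px => z hz; exists (golomb_ext h z); last exact: eK.
  have : (golomb_ext h @` prime_hull x) (golomb_ext h z) by exists z.
  by rewrite imE; apply.
have JP : golomb_ext g @` Q `<=` P.
  move=> z Jz; apply: contrapT => nPz.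
  have nzP : nonzero_ideal P.
    by split; [exact: is_ideal_prime|exists x => //; rewrite Px].
  have [r [i [Pi e]]] := prime_comaximal noethR dimR prP nzP nPz.
  have JT w : (golomb_ext g @` Q) w.
    rewrite -[w]mulr1 -e; apply: is_idealMl => //.
    by apply: is_idealD => //; [exact: is_idealMl|exact: PJ].
  have [w Qw] := JT (golomb_ext g 1).
  by move=> /(can_inj eK') w1; apply: (prime_not1 prQ); rewrite -w1.
have EP : P = golomb_ext g @` Q by apply/seteqP.
suff -> : prime_hull (val y) = Q by [].
by rewrite -imE -[X in _ @` X]Px EP; apply: can_image.
Qed.

Theorem theorem2p8 (R S : idomainType)
  (dedR : dedekind R) (dedS : dedekind S)
  (torR : torsion_class_group R) (torS : torsion_class_group S)
  (h : golomb R -> golomb S) (h_homeo : is_homeomorphism h)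
  (I : set R) (radI : is_radical_ideal I) :
  [/\ is_radical_ideal (golomb_ext h @` I),
      (primes_containing I #= primes_containing (golomb_ext h @` I))%card
    & is_prime_ideal I -> is_prime_ideal (golomb_ext h @` I)].
Proof.
have [g [hK gK ch cg]] := h_homeo.
have eK := golomb_extK hK; have eK' := golomb_extK gK.
have primes := is_prime_ideal_image dedR dedS torR torS hK gK ch cg.
have primes' := is_prime_ideal_image dedS dedR torS torR gK hK cg ch.
split; last exact: primes.
  exact: (is_radical_ideal_image dedR dedS torR hK gK ch cg).
(* Taking images is a bijection between the prime ideals of [R] and of [S]. *)
apply/card_set_bijP; exists (fun P => golomb_ext h @` P); split.
- move=> P [prP IP]; split; first exact: primes.
  exact: image_subset.
- move=> P Q _ _ PQ.
  by rewrite -(can_image P eK) PQ (can_image Q eK).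
- move=> Q [prQ IQ]; exists (golomb_ext g @` Q); last exact: can_image.
  split; first exact: primes'.
  by move=> x Ix; exists (golomb_ext h x); [apply: IQ; exists x|exact: eK].
Qed.
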